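(* Let $\mathbb{F}$ be a finite field, let $\delta,k,n$ be positive integers with $k<n$, and let $\Sigma=(A,B,C,D)$ be a linear system with $A\in\mathbb{F}^{\delta\times\delta}$, $B\in\mathbb{F}^{\delta\times k}$, $C\in\mathbb{F}^{(n-k)\times\delta}$, $D\in\mathbb{F}^{(n-k)\times k}$. The reachability of $\Sigma$ is invariant under each of the following group actions, that is, $\Sigma$ is reachable if and only if the transformed system is reachable: (i) $\Sigma\mapsto\Sigma_1=(S^{-1}AS,\,S^{-1}B,\,CS,\,D)$, for any invertible matrix $S\in\mathbb{F}^{\delta\times\delta}$; (ii) $\Sigma\mapsto\Sigma_2=(A,\,BQ,\,C,\,DQ)$, for any invertible matrix $Q\in\mathbb{F}^{k\times k}$; (iii) $\Sigma\mapsto\Sigma_3=(A,\,B,\,H^{-1}C,\,H^{-1}D)$, for any invertible matrix $H\in\mathbb{F}^{(n-k)\times(n-k)}$.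
   Context: A linear system $(A,B,C,D)$ with $A\in\mathbb{F}^{\delta\times\delta}$, $B\in\mathbb{F}^{\delta\times k}$ is called reachable if its controllability matrix $\Phi_\delta(A,B)=\begin{pmatrix}B & AB & \cdots & A^{\delta-1}B\end{pmatrix}$ has rank $\delta$. *)

(* Defs.v *)
From mathcomp Require Import all_boot all_algebra.

Set Implicit Arguments.
Unset Strict Implicit.
Unset Printing Implicit Defensive.

Import GRing.Theory.
Local Open Scope ring_scope.

                                                                              
                                             
Record linear_system (F : fieldType) (d k p : nat) := LinearSystem {
  sysA : 'M[F]_d;
  sysB : 'M[F]_(d, k);
  sysC : 'M[F]_(p, d);
  sysD : 'M[F]_(p, k)
}.

                                                                          
Definition controllability_mx (F : fieldType) (d k r : nat)
    (A : 'M[F]_d) (B : 'M[F]_(d, k)) : 'M[F]_(d, \sum_(j < r) k) :=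
  \mxrow_(j < r) (A ^+ j *m B).

Definition reachable (F : fieldType) (d k p : nat)
    (sys : linear_system F d k p) : Prop :=
  \rank (controllability_mx d (sysA sys) (sysB sys)) = d.

(* Main.v *)
Require Import Defs.
From mathcomp Require Import all_boot all_algebra.

Import GRing.Theory.
Local Open Scope ring_scope.

(** Each action multiplies the controllability matrix by an invertible matrix, so its rank is
    unchanged. A change of state basis multiplies it by [invmx S] on the left; an input change
    multiplies it on the right by the block-diagonal matrix with copies of [Q]. The output change
    leaves [A] and [B], hence the matrix itself, as they are. *)

Lemma expmx_conj (F : fieldType) (d j : nat) (S A : 'M[F]_d) :
  S \in unitmx -> (invmx S *m A *m S) ^+ j = invmx S *m A ^+ j *m S.
Proof.
move=> uS; elim: j => [|j IHj].
  by rewrite !expr0 mulmx1 mulVmx.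
by rewrite !exprS IHj -!mulmxE !mulmxA (mulmxK uS).
Qed.

(** In every block the trailing [S] of the conjugated power cancels against [invmx S *m B], leaving
    a common left factor. *)
Lemma controllability_mx_conj (F : fieldType) (d k r : nat)
    (A S : 'M[F]_d) (B : 'M[F]_(d, k)) :
  S \in unitmx ->
  controllability_mx r (invmx S *m A *m S) (invmx S *m B) =
  invmx S *m controllability_mx r A B.
Proof.
move=> uS; rewrite /controllability_mx mul_mxrow; apply: eq_mxrow => j.
by rewrite expmx_conj // !mulmxA (mulmxK uS).
Qed.

(** Right multiplication by a block-diagonal matrix cannot raise the rank. The one-sided bound is
    applied below to both [Q] and [invmx Q]. *)
Lemma mxrank_controllability_mulr (F : fieldType) (d k r : nat)
    (A : 'M[F]_d) (B : 'M[F]_(d, k)) (Q : 'M[F]_k) :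
  (\rank (controllability_mx r A (B *m Q)) <=
   \rank (controllability_mx r A B))%N.
Proof.
suff -> : controllability_mx r A (B *m Q) =
          controllability_mx r A B *m \mxdiag_(j < r) Q by exact: mxrankM_maxl.
rewrite /controllability_mx mul_mxrow_mxdiag.
by apply: eq_mxrow => j; rewrite mulmxA.
Qed.

Theorem proposition3p1 (F : finFieldType) (delta k n : nat)
    (delta_gt0 : (0 < delta)%N) (k_gt0 : (0 < k)%N) (n_gt0 : (0 < n)%N)
    (lt_k_n : (k < n)%N)
    (A : 'M[F]_delta) (B : 'M[F]_(delta, k))
    (C : 'M[F]_(n - k, delta)) (D : 'M[F]_(n - k, k)) :
  (forall S : 'M[F]_delta, S \in unitmx ->
     reachable (LinearSystem A B C D) <->
     reachable (LinearSystem (invmx S *m A *m S) (invmx S *m B) (C *m S) D))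
  /\ (forall Q : 'M[F]_k, Q \in unitmx ->
     reachable (LinearSystem A B C D) <->
     reachable (LinearSystem A (B *m Q) C (D *m Q)))
  /\ (forall H : 'M[F]_(n - k), H \in unitmx ->
     reachable (LinearSystem A B C D) <->
     reachable (LinearSystem A B (invmx H *m C) (invmx H *m D))).
Proof.
(* The output action is settled by conversion: both systems have the same [A] and [B]. *)
split; [|split] => [S uS|Q uQ|//]; rewrite /reachable /=.
  rewrite controllability_mx_conj // eqmxMfull //.
  by rewrite row_full_unit unitmx_inv.
suff -> : \rank (controllability_mx delta A (B *m Q)) =
          \rank (controllability_mx delta A B) by [].
apply/eqP; rewrite eqn_leq mxrank_controllability_mulr /=.
(* For the reverse bound, [B] is written as [B *m Q *m invmx Q], so it arises from [B *m Q] by the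
   input change [invmx Q]. *)
by rewrite -{1}(mulmxK uQ B) mxrank_controllability_mulr.
Qed.
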